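(* Let $X$ be an infinite-dimensional Banach space and let $\Lambda\leq X$ be a non-cobounded lattice, and consider the Diophantine space $(X,\mathbb{Q}\Lambda,H_{\mathrm{std}})$. The constant function $\psi_0\equiv 1$ on $(0,+\infty)$ is an optimal uniformly Dirichlet function. However, $\mathrm{BA}_{\psi_0}=\emptyset$.
   Context: Banach spaces are real. A lattice in a Banach space $X$ is a subgroup $\Lambda\leq X$ which is topologically discrete (equivalently $\min_{p\in\Lambda\setminus\{0\}}\|p\|>0$) and such that $\mathbb{R}\Lambda$ is dense in $X$, or equivalently, no proper closed subspace of $X$ contains $\Lambda$. $\Lambda$ is cobounded if its codiameter $\mathrm{codiam}(\Lambda):=\sup\{\mathrm{dist}(x,\Lambda):x\in X\}$ is finite, and non-cobounded otherwise. $\mathbb{Q}\Lambda=\{p/q:p\in\Lambda,q\in\mathbb{N}\}$ with $\mathbb{N}=\{1,2,\ldots\}$, and $H_{\mathrm{std}}(r)=\min\{q\in\mathbb{N}:qr\in\Lambda\}$ for $r\in\mathbb{Q}\Lambda$. A function $\psi:(0,+\infty)\to(0,+\infty)$ is a Dirichlet function if for every $x\in X$ there exist $C_x>0$ and a sequence $(r_n)_{n\ge1}$ in $\mathbb{Q}\Lambda$ such that $r_n\to x$ and $\|x-r_n\|\leq C_x\,\psi(H_{\mathrm{std}}(r_n))$ for all $n$; it is uniformly Dirichlet if $C_x$ can be chosen independent of $x$. A Dirichlet function $\psi$ is optimal if there is no Dirichlet function $\phi:(0,+\infty)\to(0,+\infty)$ with $\frac{\phi(q)}{\psi(q)}\to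 0$ as $q\to+\infty$. $\mathrm{BA}_\psi$ is the set of $x\in X$ for which there exists $\varepsilon>0$ such that $\|r-x\|\geq\varepsilon\,\psi(H_{\mathrm{std}}(r))$ for all $r\in\mathbb{Q}\Lambda$. *)

(* Defs.v *)
From HB Require Import structures.
From mathcomp Require Import all_boot all_order all_algebra.
From mathcomp Require Import all_classical all_reals all_analysis.

Set Implicit Arguments.
Unset Strict Implicit.
Unset Printing Implicit Defensive.

Import Order.TTheory GRing.Theory Num.Theory.
Import numFieldNormedType.Exports.

Local Open Scope classical_set_scope.
Local Open Scope ring_scope.

Section linear_span.
Context {R : realType} {V : lmodType R}.

Definition linear_span (A : set V) : set V :=
  [set x | exists n (a : 'I_n -> R) (v : 'I_n -> V),
     (forall i, A (v i)) /\ x = \sum_(i < n) a i *: v i].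

End linear_span.

Definition infinite_dimensional (R : realType) (V : lmodType R) : Prop :=
  ~ exists s : seq V, linear_span [set` s] = setT.

Section lattices.
Context {R : realType} {X : normedModType R}.

Definition topologically_discrete (A : set X) : Prop := A `<=` isolated A.

Definition is_lattice (L : set X) : Prop :=
  [/\ zmod_closed [in L], topologically_discrete L & dense (linear_span L)].

Definition codiam (L : set X) : \bar R := ereal_sup (range (edist_inf L)).

Definition cobounded (L : set X) : Prop := (codiam L < +oo)%E.

Definition rational_points (L : set X) : set X :=
  [set q%:R^-1 *: p | p in L & q in [set n | (0 < n)%N]].

(* The value is 0, which is no height, when r is not a rational point. *)
Definition H_std (L : set X) (r : X) : R :=
  if pselect (exists q, `[< (0 < q)%N /\ L (q%:R *: r) >]) is left ex_q
  then (ex_minn ex_q)%:R else 0.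

End lattices.

(* Q is the set of rational points and H the height, used only on Q. A function
   (0, +oo) -> (0, +oo) is a map psi : R -> R, used only on ]0, +oo[, such that
   positive_on_positives psi. *)
Section diophantine_spaces.
Context {R : realType} {X : normedModType R} (Q : set X) (H : X -> R).
Implicit Types (phi psi : R -> R) (x : X).

Definition positive_on_positives psi : Prop := forall t, 0 < t -> 0 < psi t.

Definition approximable_with psi (C : R) x : Prop :=
  exists r : nat -> X,
    [/\ forall n, Q (r n),
        r n @[n --> \oo] --> x
      & forall n, `|x - r n| <= C * psi (H (r n))].

Definition dirichlet psi : Prop :=
  positive_on_positives psi /\
  forall x, exists2 C : R, 0 < C & approximable_with psi C x.

Definition uniformly_dirichlet psi : Prop :=
  positive_on_positives psi /\
  exists2 C : R, 0 < C & forall x, approximable_with psi C x.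

Definition optimal psi : Prop :=
  dirichlet psi /\
  ~ exists phi, dirichlet phi /\ phi q / psi q @[q --> +oo] --> (0 : R).

Definition BA psi : set X :=
  [set x | exists2 e : R, 0 < e & forall r, Q r -> e * psi (H r) <= `|r - x|].

End diophantine_spaces.

(* Main.v *)
Require Import Defs.
From mathcomp Require Import all_boot all_order all_algebra.
From mathcomp Require Import all_classical all_reals all_analysis.
From mathcomp Require Import ring lra.

(** Rational points are dense in [X]: rounding the coefficients of a real
    combination of lattice vectors to multiples of [1/q] moves it by [O(1/q)].
    Density alone makes [1] uniformly Dirichlet, with constant [1], and leaves
    no badly approximable point: every ball around [x] contains a rational
    point.

    Optimality says that no Dirichlet function [phi] tends to [0], and this is
    where non-coboundedness enters. A non-cobounded lattice has, for every
    [rho > 0], a point of norm at most [rho] whose distance to the lattice is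
    still at least [rho / 2] ([noncobounded_tight]): take a point [w] of
    large norm for which [0] is almost a closest lattice point, and shrink it
    towards [0]. The lattice [L / M] is again non-cobounded and contains [L / q]
    for every [q] dividing [M]; so a rational point [x] can be moved by at most
    [e] to a rational point that is [e / 2]-far from all of the [L / q] with
    [q <= N] at once, for [N] as large as desired ([rational_step]).

    Iterating with steps [8^-n], and with bounds [N n] that grow as fast as
    desired, produces by completeness a point [x] such that a rational point of
    denominator at most [N n] is never closer to [x] than [8^-n / 4]
    ([badly_avoiding_point]). If [phi] tends to [0], choose [N n] so large that
    [phi q] is at most [8^-(n+1) / (n+1)] for [q > N n]. A rational point [r]
    with [|x - r| <= C * phi (H r)] then has [H r <= N n] for some [n]
    bounded in terms of [C] only, hence stays away from [x]: no such points
    converge to [x]. *)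

Set Implicit Arguments.
Unset Strict Implicit.
Unset Printing Implicit Defensive.
Import Order.TTheory GRing.Theory Num.Theory.
Import numFieldNormedType.Exports.
Local Open Scope classical_set_scope.
Local Open Scope ring_scope.

(** * Rational points of a subgroup *)

Section subgroups.
Context {R : realType} {X : normedModType R} {L : set X}.
Context (Lgrp : zmod_closed [in L]).

Lemma subgroup0 : L 0.
Proof. by case: Lgrp => /set_mem. Qed.

Lemma subgroupB u v : L u -> L v -> L (u - v).
Proof.
case: Lgrp => _ LB Lu Lv.
by apply: set_mem; apply: LB; apply: mem_set.
Qed.

Lemma subgroupN u : L u -> L (- u).
Proof. by move=> Lu; rewrite -sub0r; apply: subgroupB => //; exact: subgroup0. Qed.

Lemma subgroupD u v : L u -> L v -> L (u + v).
Proof. by move=> Lu Lv; rewrite -[v]opprK; apply/subgroupB/subgroupN. Qed.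

Lemma subgroupMn u n : L u -> L (u *+ n).
Proof.
move=> Lu; elim: n => [|n IHn]; first by rewrite mulr0n; exact: subgroup0.
by rewrite mulrS; exact: subgroupD.
Qed.

Lemma subgroupMz u m : L u -> L (u *~ m).
Proof.
move=> Lu; case: m => n; first exact: subgroupMn.
by rewrite NegzE mulrNz; exact/subgroupN/subgroupMn.
Qed.

Lemma subgroup_sum n (F : 'I_n -> X) : (forall i, L (F i)) -> L (\sum_i F i).
Proof.
move=> LF; apply: big_ind => // [|u v]; first exact: subgroup0.
exact: subgroupD.
Qed.

Lemma rational_pointsD r s :
  rational_points L r -> rational_points L s -> rational_points L (r + s).
Proof.
move=> [p Lp [m m0 <-]] [p' Lp' [n n0 <-]].
exists (p *+ n + p' *+ m); first by apply: subgroupD; exact: subgroupMn.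
exists (m * n)%N; first by rewrite /= muln_gt0 m0.
rewrite scalerDr -(scaler_nat n p) -(scaler_nat m p') !scalerA natrM.
have mR : m%:R != 0 :> R by rewrite pnatr_eq0 -lt0n.
have nR : n%:R != 0 :> R by rewrite pnatr_eq0 -lt0n.
by congr (_ *: _ + _ *: _); field; rewrite ?mR ?nR.
Qed.

Lemma rational_points_div r n : (0 < n)%N ->
  rational_points L r -> rational_points L (n%:R^-1 *: r).
Proof.
move=> n0 [p Lp [m m0 <-]]; exists p => //; exists (n * m)%N.
  by rewrite /= muln_gt0 n0.
by rewrite scalerA natrM invfM.
Qed.

(** A real combination of [v i] with coefficients [a i] is approximated by the
    one with coefficients [floor (q * a i) / q], for a single large [q]: the
    error is at most [S / q], with [S] the sum of the norms of the [v i]. *)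
Lemma rational_points_dense : dense (linear_span L) ->
  forall x (e : R), 0 < e -> exists2 r, rational_points L r & `|x - r| < e.
Proof.
move=> Ld x e e0.
have [y [xy [n [a [v [Lv yE]]]]]] :
    ball x (e / 2) `&` linear_span L !=set0.
  apply: Ld; last exact: ball_open.
  by exists x; apply: ballxx; rewrite divr_gt0.
move: xy; rewrite -ball_normE yE /= => xy.
set S := \sum_i `|v i|.
have S0 : 0 <= S by apply: sumr_ge0.
set q := (Num.truncn (S * 2 / e)).+1.
have q0 : 0 < q%:R :> R by rewrite ltr0n.
have Sq : S / q%:R < e / 2.
  have := truncnS_gt (S * 2 / e); rewrite -/q => Sq.
  rewrite ltr_pdivrMr // -ltr_pdivrMl ?divr_gt0 //.
  by apply: le_lt_trans Sq; rewrite le_eqVlt; apply/orP; left; apply/eqP; field; lra.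
exists (q%:R^-1 *: \sum_i v i *~ Num.floor (q%:R * a i)).
  exists (\sum_i v i *~ Num.floor (q%:R * a i)); last by exists q.
  by apply: subgroup_sum => i; exact: subgroupMz.
have -> : e = e / 2 + e / 2 by lra.
apply: le_lt_trans (ler_distD (\sum_i a i *: v i) _ _) _.
apply: ltrD => //; apply: le_lt_trans Sq.
rewrite scaler_sumr -sumrB mulr_suml (le_trans (ler_norm_sum _ _ _)) //.
apply: ler_sum => i _.
rewrite -scaler_int scalerA -scalerBl normrZ mulrC ler_wpM2l //.
rewrite -[X in _ <= X]ger0_norm ?invr_ge0 ?(ltW q0) //.
have -> : a i - q%:R^-1 * (Num.floor (q%:R * a i))%:~R =
          q%:R^-1 * (q%:R * a i - (Num.floor (q%:R * a i))%:~R).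
  by field; rewrite gt_eqF.
rewrite normrM ler_piMr //.
have /andP[f1 f2] := floor_itv (q%:R * a i).
by rewrite ger0_norm ?subr_ge0 //; move: f2; rewrite intrD; lra.
Qed.

End subgroups.

(** * Points far from a non-cobounded lattice *)

Lemma noncobounded_far (R : realType) (X : normedModType R) (L : set X) :
  ~ cobounded L -> forall rho : R, exists z, forall p, L p -> rho <= `|z - p|.
Proof.
move=> Lnc rho; apply: contrapT => nfar; apply: Lnc.
apply: (@le_lt_trans _ _ (rho%:E)); last exact: ltry.
apply: ge_ereal_sup => _ [z _ <-].
have [p Lp zp] : exists2 p, L p & `|z - p| < rho.
  apply: contrapT => nz; apply: nfar; exists z => p Lp.
  by rewrite leNgt; apply/negP => zp; apply: nz; exists p.
apply: (@le_trans _ _ (edist (z, p))).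
  by apply: ereal_inf_lbound; exists p.
apply: edist_fin; first exact: le_lt_trans zp.
by rewrite -ball_normE.
Qed.

Section lattice.
Context {R : realType} {X : normedModType R} {L : set X}.
Context (Llat : is_lattice L) (Lnc : ~ cobounded L).

Let Lgrp : zmod_closed [in L]. Proof. by case: Llat. Qed.

Let rational_approx x (e : R) : 0 < e ->
  exists2 r, rational_points L r & `|x - r| < e.
Proof. by case: Llat => _ _ Ld; exact: rational_points_dense. Qed.

(** Let [D >= rho] be the distance to [L] of a point far from [L]. Subtracting
    a nearly closest lattice point yields [w] with [D <= |w| < D + rho / 8],
    still at distance [D] from [L]. Since [w] and [t *: w] differ by
    [(1 - t) * |w|], the distance from [t *: w] to [L] is at least
    [t * D - rho / 8], while its norm is at most [t * D + rho / 8]: the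
    choice [t * D = 3/4 * rho] leaves room to replace [t *: w] by a rational
    point within [rho / 8]. *)
Lemma noncobounded_tight (rho : R) : 0 < rho ->
  exists y, [/\ rational_points L y, `|y| <= rho &
                forall p, L p -> rho / 2 <= `|y - p|].
Proof.
move=> rho0.
have [z zfar] := noncobounded_far Lnc rho.
pose D := inf [set `|z - p| | p in L].
have Dlb : has_lbound [set `|z - p| | p in L].
  by exists rho => _ [p Lp <-]; exact: zfar.
have Dinf : has_inf [set `|z - p| | p in L].
  split=> //; exists `|z - 0|, 0 => //; exact: (subgroup0 Lgrp).
have Dge p : L p -> D <= `|z - p| by move=> Lp; apply: ge_inf => //; exists p.
have rhoD : rho <= D.
  apply: lb_le_inf; first by case: Dinf.
  by move=> _ [p Lp <-]; exact: zfar.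
have [|_ [p0 Lp0 <-] zp0] := inf_adherent (eps := rho / 8) _ Dinf; first by lra.
pose w := z - p0; pose t := rho * (3 / 4) / D.
have wD : `|w| < D + rho / 8 by exact: zp0.
have D0 : 0 < D by lra.
have tD : t * D = rho * (3 / 4) by rewrite /t; field; lra.
have t0 : 0 <= t by rewrite /t !(mulr_ge0, invr_ge0) //; lra.
have t1 : t <= 1 by rewrite /t ler_pdivrMr //; lra.
have tw p : L p -> rho * (5 / 8) <= `|t *: w - p|.
  move=> Lp.
  have h1 : D <= `|w - p|.
    by rewrite /w -addrA -opprD; apply: Dge; exact: (subgroupD Lgrp).
  have h2 : `|w - p| <= `|w - t *: w| + `|t *: w - p| by exact: ler_distD.
  have h3 : `|w - t *: w| = (1 - t) * `|w|.
    by rewrite -{1}[w]scale1r -scalerBl normrZ ger0_norm //; lra.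
  nra.
have twn : `|t *: w| <= rho * (7 / 8).
  by rewrite normrZ ger0_norm //; nra.
have [|y Qy ty] := rational_approx (t *: w) (e := rho / 8); first by lra.
exists y; split=> // [|p Lp].
  have := ler_distD (t *: w) y 0; rewrite !subr0 (distrC y); lra.
have := ler_distD y (t *: w) p; have := tw p Lp; lra.
Qed.

(** With [x] in [L / q0] and [M = q0 * N!], the group [L / M] contains both [x]
    and every [L / q] with [q <= N]. So [x + u / M] is as far from these as [u / M]
    is from [L / M], and [u] is provided by [noncobounded_tight] at scale
    [M * e]. That the new point is rational lets the step be repeated. *)
Lemma rational_step x (e : R) N : rational_points L x -> 0 < e ->
  exists y, [/\ rational_points L y, `|y - x| <= e &
    forall q p, (0 < q <= N)%N -> L p -> e / 2 <= `|y - q%:R^-1 *: p|].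
Proof.
move=> Qx; have [p0 Lp0 [q0 q0_gt0 xE]] := Qx; move=> e0.
set M := (q0 * N`!)%N.
have M0 : (0 < M)%N by rewrite muln_gt0 q0_gt0 fact_gt0.
have MR0 : 0 < M%:R :> R by rewrite ltr0n.
have [|u [Qu un ufar]] := @noncobounded_tight (M%:R * e); first exact: mulr_gt0.
exists (x + M%:R^-1 *: u); split.
- by apply: (rational_pointsD Lgrp) => //; exact: rational_points_div.
- by rewrite addrC addKr normrZ ger0_norm ?invr_ge0 ?ler_pdivrMl // ltW.
move=> q p /andP[q_gt0 qN] Lp.
have [k NE] : exists k, N`! = (k * q)%N.
  by apply/dvdnP/dvdn_fact; rewrite q_gt0.
have qR0 : q%:R != 0 :> R by rewrite pnatr_eq0 -lt0n.
have q0R0 : q0%:R != 0 :> R by rewrite pnatr_eq0 -lt0n.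
have factR0 : N`!%:R != 0 :> R by rewrite pnatr_eq0 -lt0n fact_gt0.
have -> : x + M%:R^-1 *: u - q%:R^-1 *: p =
    M%:R^-1 *: (u - (p *+ (q0 * k) - p0 *+ N`!)).
  rewrite opprB addrA -(scaler_nat (q0 * k) p) -(scaler_nat N`! p0).
  rewrite !scalerBr scalerDr !scalerA -xE.
  rewrite [q0%:R^-1 *: p0 + _]addrC; congr (_ + _ *: _ - _ *: _).
    by rewrite /M natrM; field; rewrite q0R0 factR0.
  have kR0 : k%:R != 0 :> R.
    by move: factR0; rewrite NE natrM mulf_eq0 => /norP[].
  by rewrite /M NE !natrM; field; rewrite q0R0 qR0 kR0.
rewrite normrZ ger0_norm ?invr_ge0 ?(ltW MR0) // ler_pdivlMl //.
have := ufar _ (subgroupB Lgrp (subgroupMn Lgrp (q0 * k) Lp) (subgroupMn Lgrp N`! Lp0)).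
by rewrite mulrA.
Qed.

End lattice.

(** * Construction of a point avoiding rational points *)

Lemma geometric_limit (R : realType) (X : completeNormedModType R)
    (x : nat -> X) :
  (forall n, `|x n.+1 - x n| <= 8^-1 ^+ n :> R) ->
  exists l, forall n, `|l - x n| <= 8 / 7 * 8^-1 ^+ n.
Proof.
move=> dx.
have xnk n k : `|x (n + k)%N - x n| <= 8 / 7 * (8^-1 ^+ n - 8^-1 ^+ (n + k)).
  elim: k => [|k IHk]; first by rewrite addn0 !subrr normr0 mulr0.
  have := ler_distD (x (n + k)%N) (x (n + k.+1)%N) (x n).
  have := dx (n + k)%N; rewrite -addnS (addnS n k) exprS; lra.
have e0 k : 0 <= 8^-1 ^+ k :> R by exact: exprn_ge0.
have e_small (e : R) : 0 < e -> exists n, 8 / 7 * 8^-1 ^+ n < e.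
  move=> eps; have /cvgrPdist_lt/(_ (e / 2)) : 8^-1 ^+ n @[n --> \oo] --> (0:R).
    by apply: cvg_expr; rewrite ger0_norm; lra.
  case=> [|n _ /(_ n (leqnn n)) /=]; first by lra.
  by rewrite sub0r normrN ger0_norm // => ?; exists n; lra.
have /cauchy_cvgP cx : cauchy (x @ \oo).
  apply: cauchy_exP => e /e_small[n ne]; exists (x n), n => // m /= nm.
  rewrite -ball_normE /= distrC -(subnKC nm).
  by apply: le_lt_trans (xnk _ _) _; have := e0 (n + (m - n))%N; lra.
exists (lim (x @ \oo)) => n.
apply/ler_addgt0Pr => e e_gt0.
have /cvgrPdist_lt/(_ e e_gt0)[m _ /(_ (n + m)%N (leq_addl _ _)) /= xm] := cx.
have := ler_distD (x (n + m)%N) (lim (x @ \oo)) (x n).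
have := xnk n m; have := e0 (n + m)%N; lra.
Qed.

(** Iterating [rational_step] from [0], the step [n] gains distance [8^-n / 2]
    from the rational points of denominator at most [N n]; the later
    steps lose at most [8/7 * 8^-(n+1) = 8^-n / 7] of it, which leaves more than
    [8^-n / 4]. *)
Lemma badly_avoiding_point (R : realType) (X : completeNormedModType R)
    (L : set X) : is_lattice L -> ~ cobounded L ->
  forall N : nat -> nat, exists x, forall n q p, (0 < q <= N n)%N -> L p ->
    8^-1 ^+ n / 4 <= `|x - q%:R^-1 *: p|.
Proof.
move=> Llat Lnc N.
have e0 k : 0 < 8^-1 ^+ k :> R by exact: exprn_gt0.
have /choice[f fP] (nx : nat * X) : exists y, rational_points L nx.2 ->
    [/\ rational_points L y, `|y - nx.2| <= 8^-1 ^+ nx.1 &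
    forall q p, (0 < q <= N nx.1)%N -> L p ->
      8^-1 ^+ nx.1 / 2 <= `|y - q%:R^-1 *: p|].
  (* [0] is an arbitrary value: [f] is only iterated on rational points. *)
  have [Qx|nQx] := pselect (rational_points L nx.2); last by exists 0.
  by have [y ?] := rational_step Llat Lnc (N nx.1) Qx (e0 nx.1); exists y.
pose x := nat_rect (fun=> X) 0 (fun n y => f (n, y)).
have Qx n : rational_points L (x n).
  elim: n => [|n IHn]; last by have [] := fP (n, x n) IHn.
  exists 0; first by apply: subgroup0; case: Llat.
  by exists 1%N => //; rewrite scaler0.
have [|l lx] := @geometric_limit R X x.
  by move=> n; have [] := fP (n, x n) (Qx n).
exists l => n q p qN Lp.
have [_ _ /(_ q p qN Lp) /= xp] := fP (n, x n) (Qx n).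
have := lx n.+1; rewrite exprS distrC /=.
have := ler_distD l (f (n, x n)) (q%:R^-1 *: p).
have := e0 n; lra.
Qed.

(** * Heights and Dirichlet functions *)

Lemma H_stdP (R : realType) (X : normedModType R) (L : set X) r :
  rational_points L r ->
  exists q p, [/\ (0 < q)%N, L p, r = q%:R^-1 *: p & H_std L r = q%:R].
Proof.
move=> [p Lp [n n0 rE]]; rewrite /H_std; case: pselect => [exq|]; last first.
  case; exists n; apply/asboolP; split=> //.
  by rewrite -rE scalerA divff ?scale1r // pnatr_eq0 -lt0n.
case: ex_minnP => q /asboolP[q0 Lq] _; exists q, (q%:R *: r); split=> //.
by rewrite scalerA mulVf ?scale1r // pnatr_eq0 -lt0n.
Qed.

(** Apply [badly_avoiding_point] to bounds [N n] beyond which [phi] is below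
    [8^-(n+1) / (n+1)]. If [r] is an approximation of [x] whose height [q] satisfies
    [N n < q <= N n.+1], then [8^-(n+1) / 4 <= C * 8^-(n+1) / (n+1)], that is
    [n + 1 <= 4 * C]; so every approximation with constant [C] stays at a
    distance from [x] bounded below in terms of [C]. *)
Lemma dirichlet_not_vanishing (R : realType) (X : completeNormedModType R)
    (L : set X) (phi : R -> R) : is_lattice L -> ~ cobounded L ->
  dirichlet (rational_points L) (H_std L) phi -> ~ phi q @[q --> +oo] --> (0 : R).
Proof.
move=> Llat Lnc [phi_gt0 phiD] phi0.
have e0 k : 0 < 8^-1 ^+ k :> R by exact: exprn_gt0.
have /choice[N NP] n : exists N, (n <= N)%N /\
    forall q : nat, (N < q)%N -> phi q%:R < 8^-1 ^+ n.+1 / n.+1%:R.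
  have /cvgrPdist_lt/(_ (8^-1 ^+ n.+1 / n.+1%:R)) := phi0.
  case=> [|A [_ Aphi]]; first by rewrite divr_gt0.
  exists (maxn n (Num.truncn A).+1); split=> [|q]; first exact: leq_maxl.
  rewrite gtn_max => /andP[_ Aq].
  have /Aphi : A < q%:R.
    by apply: lt_trans (truncnS_gt A) _; rewrite ltr_nat.
  by rewrite /= sub0r normrN; apply: le_lt_trans; exact: ler_norm.
have [x xfar] := badly_avoiding_point Llat Lnc N.
have [C C0 [r [Qr rx rphi]]] := phiD x.
pose K := (Num.truncn (4 * C)).+1.
have CK : 4 * C < K%:R by exact: truncnS_gt.
have xr k : 8^-1 ^+ K / 4 <= `|x - r k|.
  have [q [p [q0 Lp rE HE]]] := H_stdP (Qr k).
  (* [n <= N n] ensures that every height is below some [N n]. *)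
  have exn : exists n, (q <= N n)%N by exists q; case: (NP q).
  case: (ex_minnP exn) => n qN nmin.
  have xn : 8^-1 ^+ n / 4 <= `|x - r k| by rewrite rE; apply: xfar; rewrite ?q0.
  suff nK : (n <= K)%N.
    apply: le_trans xn; rewrite ler_pM2r; last by lra.
    by apply: ler_wiXn2l => //; lra.
  case: n => [//|n] in qN nmin xn *.
  have Nq : (N n < q)%N by rewrite ltnNge; apply/negP => /nmin; rewrite ltnn.
  have [_ /(_ q Nq) phiq] := NP n.
  have := rphi k; rewrite HE => rk.
  rewrite -(ler_nat R); apply: le_trans (ltW CK).
  have : 8^-1 ^+ n.+1 / 4 <= C * (8^-1 ^+ n.+1 / n.+1%:R).
    by apply: le_trans xn (le_trans rk _); rewrite ler_pM2l // ltW.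
  rewrite mulrA ler_pdivlMr ?ltr0n // [X in X <= _]mulrAC.
  have := e0 n.+1; set E := 8^-1 ^+ n.+1 => E0; nra.
have /cvgrPdist_lt/(_ (8^-1 ^+ K / 4)) := rx.
case=> [|k _ /(_ k (leqnn k)) /=]; first by have := e0 K; lra.
by rewrite ltNge xr.
Qed.

Theorem theorem3p5 (R : realType) (X : completeNormedModType R) (L : set X) :
  infinite_dimensional X ->
  is_lattice L ->
  ~ cobounded L ->
  let psi0 : R -> R := cst 1 in
  [/\ uniformly_dirichlet (rational_points L) (H_std L) psi0,
      optimal (rational_points L) (H_std L) psi0
    & BA (rational_points L) (H_std L) psi0 = set0].
Proof.
move=> _ Llat Lnc psi0.
have approx x (e : R) : 0 < e ->
    exists2 r, rational_points L r & `|x - r| < e.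
  by case: Llat => Lgrp _ Ld; exact: rational_points_dense.
have psi0_gt0 : positive_on_positives psi0 by move=> t _; exact: ltr01.
have app x : approximable_with (rational_points L) (H_std L) psi0 1 x.
  have inv_gt0 n : 0 < n.+1%:R^-1 :> R by rewrite invr_gt0 ltr0n.
  have /choice[r rP] n : exists r,
      rational_points L r /\ `|x - r| < n.+1%:R^-1.
    by have [r] := approx x _ (inv_gt0 n); exists r.
  exists r; split=> [n||n]; first by case: (rP n).
    apply/cvgrPdist_lt => e e0; near=> n.
    have [_ /lt_trans] := rP n; apply; near: n.
    exact: near_infty_natSinv_lt (PosNum e0).
  have [_ /ltW/le_trans] := rP n; apply.
  by rewrite mul1r invf_le1 ?ltr0n // ler1n.
split.
- by split=> //; exists 1.
- split; first by split=> // x; exists 1.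
  case=> phi [phiD phi0]; apply: (dirichlet_not_vanishing Llat Lnc phiD).
  by under eq_fun do rewrite -[phi _]divr1.
apply/seteqP; split=> // x [e e0 xbad].
have [r Qr] := approx x e e0.
by rewrite distrC ltNge -[e]mulr1 xbad.
Unshelve. all: by end_near.
Qed.
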